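(* Let $q$ be a prime power. For every integer $m$ with $1<m\le 8$, the non-Pappus $q$-matroid $\mathcal{NP}(q)$ is not $m$-multilinear, i.e. there is no $\mathbb F_q$-linear subspace $\mathcal C\subseteq\mathbb F_q^{9\times m}$ with $\mathcal M[\mathcal C]=\mathcal{NP}(q)$.
   Context: Let $E=\mathbb F_q^9$ with standard basis $e_1,\dots,e_9$, and $\mathcal L(E)$ the set of its subspaces. Let $\mathcal S$ be the set of the eight 3-dimensional subspaces $\langle e_i,e_j,e_k\rangle$ for $\{i,j,k\}\in\{\{1,2,3\},\{1,6,8\},\{1,5,7\},\{2,4,7\},\{2,6,9\},\{3,4,8\},\{3,5,9\},\{4,5,6\}\}$. The non-Pappus $q$-matroid is $\mathcal{NP}(q)=(\mathcal L(E),\rho)$ with $\rho(U)=\dim U$ if $\dim U\le 3$ and $U\notin\mathcal S$, $\rho(U)=2$ if $U\in\mathcal S$, and $\rho(U)=3$ otherwise. For an $\mathbb F_q$-linear $\mathcal C\subseteq\mathbb F_q^{9\times m}$ of dimension $k'$, $\mathcal M[\mathcal C]$ has rank function $\rho_{\mathcal C}(U)=(k'-\dim\mathcal C(U^\perp))/m$, where $\mathcal C(W)=\{M\in\mathcal C:\operatorname{colsp}(M)\subseteq W\}$ and $U^\perp$ is the orthogonal complement under the standard dot product. For $m>1$, a $q$-matroid on $E$ is $m$-multilinear if it equals $\mathcal M[\mathcal C]$ for some such $\mathcal C\subseteq\mathbb F_q^{9\times m}$. *)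

(* Defs.v *)
From HB Require Import structures.
From mathcomp Require Import all_boot all_order all_algebra.

Set Implicit Arguments.
Unset Strict Implicit.
Unset Printing Implicit Defensive.

Import Order.TTheory GRing.Theory Num.Theory.
Local Open Scope ring_scope.

(* A q-(poly)matroid on F^n is given by its rank function on
   {vspace 'cV[F]_n}; two of them are equal when their rank functions agree
   on every subspace. *)

Section StandardDotProduct.

Variables (F : fieldType) (n : nat).

Definition cv_dot (x y : 'cV[F]_n) : F := \sum_i x i 0 * y i 0.

Fact cv_dot_bilinear :
  bilinear_for (GRing.Scale.Law.clone _ _ *%R _)
    (GRing.Scale.Law.clone _ _ (idfun \; *%R) _) cv_dot.
Proof.
split=> [x|x] a y z; rewrite /= /cv_dot [RHS]/= mulr_sumr -big_split /=;
  apply: eq_bigr => i _; rewrite !mxE.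
- by rewrite mulrDl mulrA.
- by rewrite mulrDr mulrCA.
Qed.

HB.instance Definition _ :=
  bilinear_isBilinear.Build F 'cV[F]_n 'cV[F]_n F _ _ cv_dot
    cv_dot_bilinear.

Fact cv_dot_sym x y : cv_dot x y = (-1) ^+ false * idfun (cv_dot y x).
Proof.
by rewrite expr0 mul1r; apply: eq_bigr => i _; rewrite mulrC.
Qed.

HB.instance Definition _ :=
  isHermitianSesquilinear.Build F 'cV[F]_n false idfun cv_dot cv_dot_sym.

Definition orthocomp (U : {vspace 'cV[F]_n}) : {vspace 'cV[F]_n} :=
  orthov cv_dot U.

Lemma mem_orthocomp (U : {vspace 'cV[F]_n}) (x : 'cV[F]_n) :
  reflect {in U, forall y : 'cV[F]_n, \sum_i x i 0 * y i 0 = 0}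
    (x \in orthocomp U).
Proof. exact: (@mem_orthovP _ _ _ _ cv_dot). Qed.

End StandardDotProduct.

Section RankMetricCodes.

Variables (F : fieldType) (n m : nat).
Implicit Types (C : {vspace 'M[F]_(n, m)}) (U W : {vspace 'cV[F]_n}).

Definition colsp (M : 'M[F]_(n, m)) : {vspace 'cV[F]_n} :=
  <<[seq col j M | j <- enum 'I_m]>>%VS.

Definition code_in C W : {vspace 'M[F]_(n, m)} :=
  (C :&: \bigcap_(j < m) (linfun (@col F n m j) @^-1: W))%VS.

Lemma mem_code_in C W M : (M \in code_in C W) = (M \in C) && (colsp M <= W)%VS.
Proof.
rewrite memv_cap; congr (_ && _); rewrite memvE.
apply/subv_bigcapP/span_subvP => [MW _ /mapP[j _ ->] | MW j _].
  by have := MW j isT; rewrite -memvE -memv_preim lfunE.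
by rewrite -memvE -memv_preim lfunE; apply: MW; apply: map_f; rewrite mem_enum.
Qed.

Definition code_rank C U : rat :=
  ((\dim C)%:R - (\dim (code_in C (orthocomp U)))%:R) / m%:R.

End RankMetricCodes.

Definition multilinear (F : fieldType) (n m : nat)
    (rho : {vspace 'cV[F]_n} -> nat) : Prop :=
  exists C : {vspace 'M[F]_(n, m)},
    forall U : {vspace 'cV[F]_n}, code_rank C U = (rho U)%:R.

Section NonPappus.

Variable F : fieldType.

(* The index i is 1-based: e_1, ..., e_9. *)
Definition std_vec (i : nat) : 'cV[F]_9 := \col_(k < 9) (k.+1 == i)%:R.

Definition nonPappus_triples : seq (seq nat) :=
  [:: [:: 1; 2; 3]; [:: 1; 6; 8]; [:: 1; 5; 7]; [:: 2; 4; 7];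
      [:: 2; 6; 9]; [:: 3; 4; 8]; [:: 3; 5; 9]; [:: 4; 5; 6]]%N.

Definition nonPappus_spaces : seq {vspace 'cV[F]_9} :=
  [seq <<[seq std_vec i | i <- t]>>%VS | t <- nonPappus_triples].

Definition nonPappus_rank (U : {vspace 'cV[F]_9}) : nat :=
  if U \in nonPappus_spaces then 2%N
  else if (\dim U <= 3)%N then \dim U
  else 3%N.

End NonPappus.

(* Main.v *)
(** Let q = #|F|, Q = q^m, and let k(M) be the number of vectors in the left
    kernel of a codeword M. Subspaces of dimension at most 2 are independent in
    NP(q), so double counting the pairs (M, x) and triples (M, x, y) with x, y
    in the left kernel of M evaluates the sum of (k(M) - q)(k(M) - q^2) over C
    as an explicit polynomial in q and Q. As m <= 8 < 9, every left kernel is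
    nonzero, and the left kernel of a nonzero codeword has dimension at most 3,
    with equality only if it is one of the eight dependent spaces, each of which
    accounts for fewer than Q nonzero codewords. Only these codewords and M = 0
    contribute to the sum, which is too large for that. *)

Require Import Defs.
From mathcomp Require Import all_boot all_order all_algebra all_field ring lra.

Set Implicit Arguments.
Unset Strict Implicit.
Unset Printing Implicit Defensive.

Import Order.TTheory GRing.Theory Num.Theory.
Local Open Scope ring_scope.

(** * Left kernels of codewords *)

Definition lkernel (F : fieldType) (n m : nat) (M : 'M[F]_(n, m)) :
    {vspace 'cV[F]_n} :=
  lker (linfun (mulmx M^T : 'cV[F]_n -> 'cV[F]_m)).

Lemma mem_lkernel (F : fieldType) (n m : nat) (M : 'M[F]_(n, m)) x :
  (x \in lkernel M) = (M^T *m x == 0).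
Proof. by rewrite memv_ker lfunE. Qed.

Lemma lkernel0 (F : fieldType) (n m : nat) :
  lkernel (0 : 'M[F]_(n, m)) = fullv.
Proof.
by apply/vspaceP => x; rewrite mem_lkernel trmx0 mul0mx eqxx memvf.
Qed.

Lemma dim_cV (F : fieldType) (n : nat) : \dim {: 'cV[F]_n} = n.
Proof. by rewrite dimvf; apply: muln1. Qed.

Lemma dim_lkernel (F : fieldType) (n m : nat) (M : 'M[F]_(n, m)) :
  (n <= \dim (lkernel M) + m)%N.
Proof.
have := limg_ker_dim (linfun (mulmx M^T : 'cV[F]_n -> 'cV[F]_m)) fullv.
rewrite capfv dim_cV => {1}<-; rewrite leq_add2l.
by apply: leq_trans (dimvS (subvf _)) _; rewrite dim_cV.
Qed.

(** Both [colsp M <= orthocomp U] and [U <= lkernel M] say that every column of M is orthogonal to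
    all of U. *)
Lemma mem_code_orthocomp (F : fieldType) (n m : nat)
    (C : {vspace 'M[F]_(n, m)}) (U : {vspace 'cV[F]_n}) M :
  (M \in code_in C (orthocomp U)) = (M \in C) && (U <= lkernel M)%VS.
Proof.
rewrite mem_code_in; congr (_ && _).
have lkE (j : 'I_m) y : (M^T *m y) j 0 = \sum_i col j M i 0 * y i 0.
  by rewrite mxE; apply: eq_bigr => i _; rewrite !mxE.
apply/span_subvP/subvP => [MU x Ux | UM _ /mapP[j _ ->]].
  rewrite mem_lkernel; apply/eqP/colP => j; rewrite lkE mxE.
  by apply/mem_orthocomp: Ux; apply: MU; apply/map_f; rewrite mem_enum.
apply/mem_orthocomp => y /UM; rewrite mem_lkernel => /eqP My0.
by rewrite -lkE My0 mxE.
Qed.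

(** * Dimensions and ranks in the non-Pappus q-matroid *)

Lemma free_std_vec (F : fieldType) (t : seq nat) :
  all (fun i => 0 < i <= 9)%N t -> uniq t -> free [seq std_vec F i | i <- t].
Proof.
have dotE i j : (0 < i <= 9)%N ->
    ((std_vec F i)^T *m std_vec F j == 0) = (i != j).
  case: i => // i /= i9.
  have -> : (std_vec F i.+1)^T *m std_vec F j = (i.+1 == j)%:R%:M.
    apply/matrixP => a b; rewrite !ord1 !mxE (bigD1 (Ordinal i9)) //= !mxE.
    rewrite eqxx mul1r big1 ?addr0 // => k; rewrite -val_eqE /= => /negPf ki.
    by rewrite !mxE eqSS ki mul0r.
  by case: (_ == j); [apply: oner_eq0 | rewrite raddf0 eqxx].
elim: t => [|i t IHt] /=; first by rewrite nil_free.
case/andP=> i9 t9 /andP[it ut]; rewrite free_cons IHt // andbT.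
(* The vectors indexed by [t] are orthogonal to [std_vec F i], hence so is their span, whereas
   [std_vec F i] is not orthogonal to itself. *)
apply/negP => /(subvP _) iS.
have /iS : (<<[seq std_vec F i | i <- t]>> <= lkernel (std_vec F i))%VS.
  apply/span_subvP => _ /mapP[j tj ->]; rewrite mem_lkernel dotE //.
  by apply: contraNneq it => ->.
by rewrite mem_lkernel dotE ?eqxx.
Qed.

Lemma dim_nonPappus_spaces (F : fieldType) U :
  U \in nonPappus_spaces F -> \dim U = 3.
Proof.
case/mapP=> t tS ->.
have: all (fun t => [&& all (fun i => 0 < i <= 9)%N t, uniq t & size t == 3])
  nonPappus_triples by [].
move/allP/(_ _ tS)/and3P=> [t9 ut /eqP <-].
by rewrite -(size_map (std_vec F)); apply/eqP/free_std_vec.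
Qed.

Lemma nonPappus_rank_small (F : fieldType) (U : {vspace 'cV[F]_9}) :
  (\dim U <= 2)%N -> nonPappus_rank U = \dim U.
Proof.
rewrite /nonPappus_rank => dU; case: ifP => [/dim_nonPappus_spaces dU3|_].
  by rewrite dU3 in dU.
by rewrite (leq_trans dU).
Qed.

Lemma nonPappus_rank_large (F : fieldType) (U : {vspace 'cV[F]_9}) :
  (2 < \dim U)%N -> U \notin nonPappus_spaces F -> nonPappus_rank U = 3.
Proof.
rewrite /nonPappus_rank => dU /negPf ->; case: leqP => // dU3.
by apply/eqP; rewrite eqn_leq dU3.
Qed.

(** * Counting vectors and codewords *)

Lemma sum_mem_notin (F : finFieldType) (n : nat) (V U : {vspace 'cV[F]_n}) :
  (V <= U)%VS ->
  \sum_(y : 'cV[F]_n | y \notin V) (y \in U)%:R = #|F|%:R ^+ \dim U - #|F|%:R ^+ \dim V :> int.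
Proof.
move=> VU; rewrite -!natrX -!card_vspace.
have -> : #|U|%:R = \sum_y (y \in U)%:R :> int.
  by rewrite -sum1_card natr_sum big_mkcond; apply: eq_bigr => y _; case: ifP.
rewrite [in RHS](bigID (mem V)) /= [in RHS](eq_bigr (fun=> 1)) => [|y Vy]; last first.
  by rewrite (subvP VU y Vy).
rewrite sumr_const [RHS]addrAC (_ : _ - _ = 0) ?add0r //; apply/eqP.
by rewrite subr_eq0.
Qed.

Lemma sum_mem_neq0 (F : finFieldType) (n : nat) (U : {vspace 'cV[F]_n}) :
  \sum_(x : 'cV[F]_n | x != 0%R) (x \in U)%:R = #|F|%:R ^+ \dim U - 1 :> int.
Proof.
have := sum_mem_notin (sub0v U); rewrite dimv0 => <-.
by apply: eq_bigl => x; rewrite memv0.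
Qed.

Lemma sum_mem_notin_line (F : finFieldType) (n : nat) (U : {vspace 'cV[F]_n})
    (x : 'cV[F]_n) : x != 0 -> x \in U ->
  \sum_(y : 'cV[F]_n | y \notin <[x]>%VS) (y \in U)%:R
    = #|F|%:R ^+ \dim U - #|F|%:R :> int.
Proof. by move=> x0 xU; rewrite sum_mem_notin -?memvE // dim_vline x0. Qed.

(** The right side is the value of the moment for n = 9 and r = 3; the left side bounds the
    contributions of M = 0 and of the eight dependent spaces. For m = 8 the higher powers on the
    right cancel, leaving q^24 - q^17 - q^16 + q^9. *)
Lemma moment_gap (q : int) (m : nat) : 2 <= q -> (1 < m)%N -> (m <= 8)%N ->
  (q ^+ 9 - q) * (q ^+ 9 - q ^+ 2)
    + 8 * (q ^+ m * ((q ^+ 3 - q) * (q ^+ 3 - q ^+ 2)))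
  < (q ^+ 9 - 1) * (q ^+ 9 - q) * q ^+ m
    - (q ^+ 2 - 1) * (q ^+ 9 - 1) * (q ^+ m) ^+ 2
    + (q ^+ 2 - 1) * (q - 1) * (q ^+ m) ^+ 3.
Proof.
move=> q2.
(* These make the inequality linear in the monomials q ^+ k. *)
have qS k : 2 * q ^+ k <= q ^+ k.+1.
  by rewrite exprS ler_wpM2r // exprn_ge0 //; lra.
move: (qS 0%N) (qS 1%N) (qS 2%N) (qS 3%N) (qS 4%N) (qS 5%N) (qS 6%N) (qS 7%N).
move: (qS 8%N) (qS 9%N) (qS 10%N) (qS 11%N) (qS 12%N) (qS 13%N) (qS 14%N) (qS 15%N).
move: (qS 16%N) (qS 17%N) (qS 18%N) (qS 19%N) (qS 20%N) (qS 21%N) (qS 22%N) (qS 23%N).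
move: (qS 24%N) (qS 25%N) (qS 26%N) => {qS}.
(* Once [m] is a numeral from 2 to 8, every exponent is a numeral of at most 3 + 3 * 8 = 27. *)
do 9?[case: m => [|m] //]; rewrite -!exprM => *; lra.
Qed.

Lemma sum_mem_code (F : finFieldType) (n m : nat) (C : {vspace 'M[F]_(n, m)})
    (U : {vspace 'cV[F]_n}) :
  \sum_(M in C) ((U <= lkernel M)%VS)%:R
    = #|F|%:R ^+ \dim (code_in C (orthocomp U)) :> int.
Proof.
rewrite -natrX -card_vspace -sum1_card natr_sum.
rewrite big_mkcond [RHS]big_mkcond; apply: eq_bigr => M _ /=.
by rewrite mem_code_orthocomp; case: (M \in C); case: (U <= _)%VS.
Qed.

(** * Moments of the left-kernel sizes *)

Section Moments.

Variables (F : finFieldType) (n m r : nat) (C : {vspace 'M[F]_(n, m)}).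

Local Notation q := (#|F|%:R : int).
Local Notation Q := (q ^+ m).

Hypothesis dimC : \dim C = (r * m)%N.
Hypothesis dimC1 : forall x : 'cV[F]_n, x != 0 ->
  \dim (code_in C (orthocomp <[x]>)) = (r.-1 * m)%N.
Hypothesis dimC2 : forall x y : 'cV[F]_n, x != 0 -> y \notin <[x]>%VS ->
  \dim (code_in C (orthocomp (<[x]> + <[y]>))) = (r.-2 * m)%N.

Lemma lkernel_moment0 : \sum_(M in C) 1 = Q ^+ r.
Proof. by rewrite sumr_const card_vspace dimC natrX mulnC exprM. Qed.

Lemma lkernel_moment1 :
  \sum_(M in C) (q ^+ \dim (lkernel M) - 1) = (q ^+ n - 1) * Q ^+ r.-1.
Proof.
under eq_bigr do rewrite -sum_mem_neq0.
rewrite exchange_big -[n in RHS](dim_cV F) -sum_mem_neq0 mulr_suml /=.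
apply: eq_bigr => x x0.
by rewrite memvf mul1r -exprM mulnC -(dimC1 x0) -sum_mem_code.
Qed.

(** The product counts the ordered pairs of independent vectors in [lkernel M]. After exchanging
    sums, each pair contributes the number of codewords whose left kernel contains its span. *)
Lemma lkernel_moment2 :
  \sum_(M in C) (q ^+ \dim (lkernel M) - 1) * (q ^+ \dim (lkernel M) - q)
    = (q ^+ n - 1) * (q ^+ n - q) * Q ^+ r.-2.
Proof.
transitivity (\sum_(M in C) \sum_(x : 'cV[F]_n | x != 0)
    \sum_(y : 'cV[F]_n | y \notin <[x]>%VS)
      ((<[x]> + <[y]> <= lkernel M)%VS)%:R : int).
  apply: eq_bigr => M _; rewrite -sum_mem_neq0 mulr_suml.
  apply: eq_bigr => x x0; under [RHS]eq_bigr do rewrite subv_add -!memvE.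
  case: (boolP (x \in _)) => xM; last by rewrite mul0r big1.
  by rewrite mul1r -(sum_mem_notin_line x0).
rewrite exchange_big -mulrA -[n in q ^+ n - 1](dim_cV F) -sum_mem_neq0.
rewrite mulr_suml; apply: eq_bigr => x x0.
rewrite memvf mul1r -[n in q ^+ n - q](dim_cV F).
rewrite -(sum_mem_notin_line x0) ?memvf // exchange_big mulr_suml.
apply: eq_bigr => y yx.
by rewrite memvf mul1r -exprM mulnC -(dimC2 x0 yx) -sum_mem_code.
Qed.

(** The weight vanishes on left kernels of dimension 1 and 2. The identity (k - q)(k - q^2) = (k -
    1)(k - q) - (q^2 - 1)(k - 1) + (q^2 - 1)(q - 1) reduces it to the previous moments. *)
Lemma lkernel_moment :
  \sum_(M in C) (q ^+ \dim (lkernel M) - q) * (q ^+ \dim (lkernel M) - q ^+ 2)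
    = (q ^+ n - 1) * (q ^+ n - q) * Q ^+ r.-2
      - (q ^+ 2 - 1) * (q ^+ n - 1) * Q ^+ r.-1
      + (q ^+ 2 - 1) * (q - 1) * Q ^+ r.
Proof.
rewrite -lkernel_moment2 -[_ * _ * Q ^+ r.-1]mulrA -lkernel_moment1.
rewrite -lkernel_moment0 !mulr_sumr -sumrB -big_split /=.
apply: eq_bigr => M _; move: (q ^+ \dim _) => k; move: q => p; ring.
Qed.

End Moments.

Theorem theorem5p4 (F : finFieldType) (m : nat) :
  (1 < m)%N -> (m <= 8)%N -> ~ multilinear m (@nonPappus_rank F).
Proof.
move=> m1 m8 [C CE].
pose q : int := #|F|%:R.
have q2 : 2 <= q by rewrite ler_nat finRing_gt1.
have m0 : (0 < m)%N by apply: leq_trans m1.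
have dimCU U : \dim C = (\dim (code_in C (orthocomp U)) + nonPappus_rank U * m)%N.
  apply/eqP; rewrite -(eqr_nat rat) natrD natrM -(CE U) /code_rank.
  by rewrite divfK ?pnatr_eq0 -?lt0n // addrC subrK.
have rank3 (U : {vspace 'cV[F]_9}) : (3 < \dim U)%N -> nonPappus_rank U = 3%N.
  move=> dU; apply: nonPappus_rank_large (ltnW dU) _.
  by apply/negP => /dim_nonPappus_spaces dU3; rewrite dU3 in dU.
have dimC : \dim C = (3 * m)%N.
  (* Only M = 0 has full left kernel: applying the transpose of M to the standard vectors reads off
     its entries. *)
  rewrite (dimCU fullv) rank3 ?dim_cV //.
  apply/eqP; rewrite -[X in _ == X]add0n eqn_add2r dimv_eq0 -subv0.
  apply/subvP => M; rewrite mem_code_orthocomp memv0 => /andP[_ kM].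
  apply/eqP/trmx_inj/matrixP => i j; rewrite trmx0.
  have /(subvP kM) := memvf (std_vec F j.+1); rewrite mem_lkernel => /eqP/colP/(_ i).
  rewrite !mxE (bigD1 j) //= !mxE eqxx mulr1 big1 ?addr0 // => k.
  by rewrite !mxE eqSS val_eqE => /negPf ->; rewrite mulr0.
have dimU U : \dim (code_in C (orthocomp U)) = ((3 - nonPappus_rank U) * m)%N.
  by rewrite mulnBl -dimC (dimCU U) addnK.
have code0 U M : nonPappus_rank U = 3%N -> M \in C -> (U <= lkernel M)%VS -> M = 0.
  move=> U3 MC UM; have := dimU U; rewrite U3 mul0n => /eqP.
  rewrite dimv_eq0 => /eqP CU0; apply/eqP; rewrite -memv0 -CU0.
  by rewrite mem_code_orthocomp MC.
have dim1 (x : 'cV[F]_9) : x != 0 -> \dim (code_in C (orthocomp <[x]>)) = (2 * m)%N.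
  by move=> x0; rewrite dimU nonPappus_rank_small dim_vline x0.
have dim2 (x y : 'cV[F]_9) : x != 0 -> y \notin <[x]>%VS ->
    \dim (code_in C (orthocomp (<[x]> + <[y]>))) = (1 * m)%N.
  move=> x0 yx; have dxy : \dim (<[x]> + <[y]>) = 2.
    have: free [:: y; x] by rewrite free_cons span_seq1 yx seq1_free.
    by rewrite /free span_cons span_seq1 addvC => /eqP.
  by rewrite dimU nonPappus_rank_small dxy.
have := lkernel_moment dimC dim1 dim2; rewrite -/q /= expr1 => momE.
have := moment_gap q2 m1 m8; rewrite -momE ltNge => /negP; apply.
(* [b] is the weight of a codeword whose left kernel has dimension 3. *)
pose b := (q ^+ 3 - q) * (q ^+ 3 - q ^+ 2).
have b0 : 0 <= b.
  have q1 : 1 <= q by apply: le_trans q2.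
  apply: mulr_ge0; rewrite subr_ge0; last exact: ler_weXn2l.
  exact: (ler_weXn2l q1 (isT : 1 <= 3)%N).
(* A dependent space has rank 2, so exactly q^m codewords, M = 0 included, have a left kernel
   containing it. *)
have -> : 8 * (q ^+ m * b) = \sum_(U <- nonPappus_spaces F) \sum_(M in C) ((U <= lkernel M)%VS)%:R * b.
  rewrite big_seq; under eq_bigr => U US.
    rewrite -mulr_suml sum_mem_code dimU /nonPappus_rank US mul1n -/q.
    over.
  by rewrite -big_seq big_const_seq count_predT size_map /=; lra.
(* The term of M = 0 in the moment cancels the first term of the bound; its nonnegative share of the
   double sum is then dropped. *)
rewrite exchange_big (bigD1 0) ?mem0v //= lkernel0 dim_cV lerD2l.
have ge0 (M : 'M_(9, m)) (s : seq {vspace 'cV[F]_9}) :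
    0 <= \sum_(U <- s) ((U <= lkernel M)%VS)%:R * b.
  by apply: sumr_ge0 => U _; rewrite mulr_ge0 ?ler0n.
rewrite [leRHS](bigD1 0) ?mem0v //= ler_wpDl //.
apply: ler_sum => M /andP[MC M0].
have d3 : (\dim (lkernel M) <= 3)%N.
  by rewrite leqNgt; apply: contra_neqN M0 => /rank3 r3; exact: code0 r3 MC (subvv _).
(* A zero left kernel would carry the positive weight (1 - q)(1 - q^2); the dimension is at least 9
   - m, hence positive. *)
have d1 : (0 < \dim (lkernel M))%N.
  by have := leq_trans (dim_lkernel M) (leq_add (leqnn _) m8); case: (\dim _).
have [d | d2] := leqP (\dim (lkernel M)) 2.
  apply: (le_trans _ (ge0 M _)); move: d d1; case: (\dim _) => [|[|[|]]] // _ _.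
    by rewrite expr1 subrr mul0r.
  by rewrite subrr mulr0.
(* A left kernel of dimension 3 outside the eight spaces would have rank 3, forcing M = 0. *)
have MS : lkernel M \in nonPappus_spaces F.
  apply: contra_neqT M0 => MS.
  by apply: code0 MC (subvv _); apply: nonPappus_rank_large.
rewrite (big_rem _ MS) /= subvv mul1r (dim_nonPappus_spaces MS).
by rewrite lerDl.
Qed.
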